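(* Let $K$ be a field, let $0<a<b<c$ be integers, and let $I=(x^c,\,x^by^a,\,x^ay^b,\,y^c)\subset K[x,y]$ be the symmetric ideal attached to this sequence. Then the fiber cone $F(I)$ is Cohen--Macaulay for all $c\notin[2a+1,\,r(b-a)+a]$, where $r=\lceil b/(b-a)\rceil$.
   Context: With $\mathfrak m=(x,y)\subset K[x,y]$, the fiber cone of $I$ is the standard graded $K$-algebra $F(I)=\bigoplus_{k\ge0}I^k/\mathfrak mI^k$. *)

(* Defs.v *)
From HB Require Import structures.
From mathcomp Require Import all_boot all_order all_algebra.
From mathcomp Require Import ring_quotient.
From mathcomp Require Import boolp.
From mathcomp Require Import mpoly.

Set Implicit Arguments.
Unset Strict Implicit.
Unset Printing Implicit Defensive.

Import Order.TTheory GRing.Theory Num.Theory.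
Local Open Scope ring_scope.
Local Open Scope quotient_scope.

Section Ideals.
Variable R : comNzRingType.
Implicit Types (I J : R -> Prop) (P : {pred R}) (s : seq R) (d : nat).

Definition ideal_gen s : R -> Prop :=
  fun f => exists c : 'I_(size s) -> R, f = \sum_(i < size s) c i * s`_i.

Definition idealM I J : R -> Prop :=
  fun f => exists (n : nat) (u v : 'I_n -> R),
    [/\ forall i, I (u i), forall i, J (v i) & f = \sum_(i < n) u i * v i].

Fixpoint idealX I (k : nat) : R -> Prop :=
  if k is k'.+1 then idealM I (idealX I k') else fun=> True.

(* [idealr_closed] includes that P is proper. The ambient logic being
   classical, boolean predicates represent arbitrary subsets of R. *)
Definition prime_ideal P : Prop := idealr_closed P /\ prime_idealr_closed P.

Definition prime_chain d (P : 'I_d.+1 -> {pred R}) : Prop :=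
  (forall i, prime_ideal (P i)) /\
  (forall i j : 'I_d.+1, (i < j)%N ->
     {subset P i <= P j} /\ ~ {subset P j <= P i}).

Definition has_krull_dim d : Prop :=
  (exists P : 'I_d.+1 -> {pred R}, prime_chain P) /\
  (forall n (P : 'I_n.+1 -> {pred R}), prime_chain P -> (n <= d)%N).

Definition regular_sequence s : Prop :=
  (forall i, (i < size s)%N -> forall u,
     ideal_gen (take i s) (s`_i * u) -> ideal_gen (take i s) u) /\
  ~ ideal_gen s 1.

Definition has_depth I d : Prop :=
  (exists s, [/\ {in s, forall f, I f}, regular_sequence s & size s = d]) /\
  (forall s, {in s, forall f, I f} -> regular_sequence s -> (size s <= d)%N).

(* For R a standard graded algebra over a field and M its graded maximal
   ideal: depth R = dim R, where depth R is the depth of R in M. *)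
Definition graded_cohen_macaulay (M : R -> Prop) : Prop :=
  exists d, has_krull_dim d /\ has_depth M d.

Lemma idealM_add I J f g : idealM I J f -> idealM I J g -> idealM I J (f + g).
Proof.
move=> [n [u [v [Iu Jv ->]]]] [m [u' [v' [Iu' Jv' ->]]]].
exists (n + m)%N, (fun i => match split i with inl j => u j | inr j => u' j end),
  (fun i => match split i with inl j => v j | inr j => v' j end).
split=> [i|i|]; [by case: split | by case: split |].
rewrite big_split_ord /=; congr (_ + _); apply: eq_bigr => i _.
  by rewrite -[lshift _ _]/(unsplit (inl i)) unsplitK.
by rewrite -[rshift _ _]/(unsplit (inr i)) unsplitK.
Qed.

Lemma idealM0 I J : idealM I J 0.
Proof.
exists 0%N, (fun=> 0), (fun=> 0); split; [by case | by case |].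
by rewrite big_ord0.
Qed.

Lemma idealM_sum I J n (F : 'I_n -> R) :
  (forall i, idealM I J (F i)) -> idealM I J (\sum_(i < n) F i).
Proof.
move=> IF; apply: (big_ind (idealM I J)) => [|f g|i _]; last exact: IF.
  exact: idealM0.
exact: idealM_add.
Qed.

Lemma idealM_mul I J f g : I f -> J g -> idealM I J (f * g).
Proof.
move=> If Jg; exists 1%N, (fun=> f), (fun=> g); split=> //.
by rewrite big_ord1.
Qed.

Lemma idealX_mull I k a f : idealX I k f -> idealX I k (a * f).
Proof.
elim: k a f => [//|k IHk] a f [n [u [v [Iu Iv ->]]]].
exists n, u, (fun i => a * v i); split=> [||]; [exact: Iu | by move=> i; apply: IHk; apply: Iv |].
by rewrite mulr_sumr; apply: eq_bigr => i _; rewrite mulrCA.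
Qed.

Lemma idealX0 I k : idealX I k 0.
Proof. by case: k => //= k; apply: idealM0. Qed.

Lemma idealX_add I k f g : idealX I k f -> idealX I k g -> idealX I k (f + g).
Proof. by case: k => //= k; apply: idealM_add. Qed.

Lemma idealX_mul I j k f g :
  idealX I j f -> idealX I k g -> idealX I (j + k) (f * g).
Proof.
elim: j f => [|j IHj] f; first by move=> _ Ig; apply: idealX_mull.
move=> [n [u [v [Iu Iv ->]]]] Ig; rewrite mulr_suml; apply: idealM_sum => i.
by rewrite -mulrA; apply: idealM_mul; [apply: Iu | apply: IHj (Iv i) Ig].
Qed.

Lemma idealMX_mul I J j k f g :
  idealM J (idealX I j) f -> idealX I k g -> idealM J (idealX I (j + k)) (f * g).
Proof.
move=> [n [u [v [Ju Iv ->]]]] Ig; rewrite mulr_suml; apply: idealM_sum => i.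
by rewrite -mulrA; apply: idealM_mul; [apply: Ju | apply: idealX_mul (Iv i) Ig].
Qed.

(* The Rees algebra: polynomials \sum_k p_k t^k with p_k in I^k. *)
Definition rees_pred I : {pred {poly R}} :=
  fun p => `[< forall k, idealX I k p`_k >].

Lemma rees_predP I (p : {poly R}) :
  reflect (forall k, idealX I k p`_k) (p \in rees_pred I).
Proof. exact: asboolP. Qed.

Lemma rees_subring I : subring_closed (rees_pred I).
Proof.
split=> [|p q /rees_predP Ip /rees_predP Iq|p q /rees_predP Ip /rees_predP Iq];
  apply/rees_predP => k.
- by rewrite coef1; case: k => [//|k] /=; apply: idealM0.
- by rewrite coefB -mulN1r; apply/idealX_add/idealX_mull.
- rewrite coefM; apply: big_ind => [|f g|i _].
  + exact: idealX0.
  + exact: idealX_add.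
  + by have := idealX_mul (Ip i) (Iq (k - i)%N); rewrite subnKC // -ltnS.
Qed.

HB.instance Definition _ I :=
  GRing.isSubringClosed.Build {poly R} (rees_pred I) (rees_subring I).

Record rees I := Rees {
  rees_val :> {poly R};
  rees_valP : rees_val \in rees_pred I
}.

HB.instance Definition _ I := [isSub for @rees_val I].
HB.instance Definition _ I := [Choice of rees I by <:].
HB.instance Definition _ I := [SubChoice_isSubComNzRing of rees I by <:].

End Ideals.

Section FiberCone.
Variable K : fieldType.

Definition mX : {mpoly K[2]} := 'X_ord0.
Definition mY : {mpoly K[2]} := 'X_ord_max.

Definition ideal_xy : {mpoly K[2]} -> Prop := ideal_gen [:: mX; mY].

Lemma ideal_xy_eval0 f : ideal_xy f -> f.@[fun=> 0] = 0.
Proof.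
move=> [c ->]; rewrite 2!big_ord_recl big_ord0 /= !mevalD !mevalM /mX /mY.
by rewrite !mevalXU !mulr0 meval0 !addr0.
Qed.

Variable I : {mpoly K[2]} -> Prop.

(* The ideal of the Rees algebra whose degree k component is m I^k. *)
Definition fiber_ideal : {pred rees I} :=
  fun p => `[< forall k, idealM ideal_xy (idealX I k) (rees_val p)`_k >].

Lemma fiber_idealP (p : rees I) :
  reflect (forall k, idealM ideal_xy (idealX I k) (rees_val p)`_k)
          (p \in fiber_ideal).
Proof. exact: asboolP. Qed.

Lemma fiber_idealr : idealr_closed fiber_ideal.
Proof.
split=> [||a p q /fiber_idealP mp /fiber_idealP mq].
- by apply/fiber_idealP => k; rewrite /= coef0; apply: idealM0.
- apply/fiber_idealP => /(_ 0%N) /=; rewrite coef1 /=.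
  move=> [n [u [v [mu _ /(congr1 (fun f => f.@[fun=> 0]))]]]].
  rewrite meval1 rmorph_sum big1 => [/eqP|i _]; first by rewrite oner_eq0.
  by rewrite /= mevalM ideal_xy_eval0 ?mul0r.
- apply/fiber_idealP => k /=; rewrite coefD; apply: idealM_add => //.
  have /rees_predP Ia := rees_valP a.
  rewrite mulrC coefM; elim/big_ind: _ => [|f g|i _].
  + exact: idealM0.
  + exact: idealM_add.
  + by have := idealMX_mul (mp i) (Ia (k - i)%N); rewrite subnKC // -ltnS.
Qed.

HB.instance Definition _ :=
  isIdealr.Build (rees I) fiber_ideal fiber_idealr.

(* (\bigoplus_k I^k) / (\bigoplus_k m I^k) = \bigoplus_k I^k / m I^k *)
Definition fiber_cone : comNzRingType := {ideal_quot fiber_ideal}.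

(* \bigoplus_(k > 0) I^k / m I^k, the graded maximal ideal of the fiber cone *)
Definition fiber_cone_plus : fiber_cone -> Prop :=
  fun f => exists p : rees I,
    (rees_val p)`_0 = 0 /\ f = \pi_({ideal_quot fiber_ideal}) p.

End FiberCone.

Arguments fiber_ideal {K} I _.
Arguments fiber_cone {K} I.
Arguments fiber_cone_plus {K} I _.

Definition fiber_cone_CM (K : fieldType) (I : {mpoly K[2]} -> Prop) : Prop :=
  graded_cohen_macaulay (fiber_cone_plus I).

Definition symmetric_ideal (K : fieldType) (a b c : nat) :
    {mpoly K[2]} -> Prop :=
  ideal_gen [:: mX K ^+ c; mX K ^+ b * mY K ^+ a;
                mX K ^+ a * mY K ^+ b; mY K ^+ c].
Arguments symmetric_ideal : clear implicits.

(* Main.v *)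
From HB Require Import structures.
From mathcomp Require Import all_boot all_order all_algebra.
From mathcomp Require Import ring_quotient boolp mpoly zify ring.
Require Import Defs.

Set Implicit Arguments.
Unset Strict Implicit.
Unset Printing Implicit Defensive.

Import Order.TTheory GRing.Theory Num.Theory.
Local Open Scope ring_scope.
Local Open Scope quotient_scope.

(** Write T0, T1, T2, T3 for the classes of x^c, x^b y^a, x^a y^b, y^c in the
    fiber cone F.  A product of k generators of I is zero in F exactly when it
    is, in K[x, y], a proper multiple of another such product, and the nonzero
    products are linearly independent as soon as they have distinct exponents.
    So F is the quotient of K[T0, T1, T2, T3] by the span of the monomials
    outside a set N of standard monomials, whenever N satisfies two
    combinatorial conditions: the exponents of the elements of N of a given
    degree are distinct and incomparable, and each monomial outside N is
    properly divisible, in K[x, y], by one of the same degree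
    ([fiber_param_ker], [fiber_param_surj]).

    Put d = b - a and q = r - 1, where r is the ceiling of b / d.
    - If c <= 2a, the monomials T1 T1, T1 T2, T2 T2 are proper multiples of
      T0 T3 in K[x, y], hence vanish in F, and N is given by
      deg_T1 + deg_T2 <= 1: F is free over K[T0, T3] with basis 1, T1, T2, and
      T0, T3 is a regular sequence ([symmetric_CM_low]).
    - If c > r d + a, the points (c, 0), (b, a), (a, b), (0, c) are in convex
      position and F = K[T] / (T0 T3, T0 T2^q, T3 T1^q), a determinantal ideal
      of height 2.  Here T0 + T2, T1 + T3 is a regular sequence; this is checked
      on coefficients ([high_regular1], [high_regular2], [symmetric_CM_high]).

    It remains to see that dim F = 2 and that depth F is at most 2.  In
    both cases all the monomials in some two variables are standard, which gives
    a chain of three monomial primes.  For the upper bounds,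
    N grows quadratically, so any three elements x, y, z of F satisfy a
    nontrivial polynomial relation over K.  Isolating its lexicographically
    least monomial gives
      x^m0 (y^m1 (z^m2 (1 + a2 z) + a1 y) + a0 x) = 0,
    and such a relation is incompatible both with a chain P0 < P1 < P2 < P3 of
    primes (take x, y, z in the successive differences) and with a regular
    sequence x, y, z: in either case the factors x, y, z are cancelled one after
    the other until 1 lies in a proper ideal.  This is the constructive
    characterization of Krull dimension by Coquand and Lombardi. *)

(** * Bounding dimension and depth by algebraic dependence *)

Section Ideals.
Variable A : comNzRingType.
Implicit Types (s : seq A) (x y z f : A).

Lemma ideal_gen_nil f : ideal_gen [::] f <-> f = 0.
Proof.
split=> [[c ->]|->]; first by rewrite big_ord0.
by exists (fun=> 0); rewrite big_ord0.
Qed.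

Lemma ideal_gen_cons x s f :
  ideal_gen (x :: s) f <-> exists c g, ideal_gen s g /\ f = c * x + g.
Proof.
split=> [[c ->]|[c [g [[d ->] ->]]]].
  rewrite big_ord_recl /=; exists (c ord0), (\sum_(i < size s) c (lift ord0 i) * s`_i).
  by split=> //; exists (fun i => c (lift ord0 i)).
exists (fun i => if unlift ord0 i is Some j then d j else c).
rewrite big_ord_recl /= unlift_none; congr (_ + _); apply: eq_bigr => i _.
by rewrite liftK.
Qed.

Lemma ideal_gen1 x f : ideal_gen [:: x] f <-> exists c, f = c * x.
Proof.
rewrite ideal_gen_cons; split=> [[c [g [/ideal_gen_nil -> ->]]]|[c ->]].
  by exists c; rewrite addr0.
by exists c, 0; rewrite addr0 ideal_gen_nil.
Qed.

Lemma ideal_gen2 x y f :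
  ideal_gen [:: x; y] f <-> exists c d, f = c * x + d * y.
Proof.
rewrite ideal_gen_cons; split=> [[c [g [/ideal_gen1[d ->] ->]]]|[c [d ->]]].
  by exists c, d.
by exists c, (d * y); split=> //; apply/ideal_gen1; exists d.
Qed.

Lemma ideal_gen_mem s x : x \in s -> ideal_gen s x.
Proof.
elim: s => // y s IHs; rewrite inE => /predU1P[->|/IHs sx]; apply/ideal_gen_cons.
  exists 1, 0; split; last by rewrite mul1r addr0.
  by exists (fun=> 0); rewrite big1 // => i; rewrite mul0r.
by exists 0, x; rewrite mul0r add0r.
Qed.

Lemma ideal_gen0 s : ideal_gen s 0.
Proof. by exists (fun=> 0); rewrite big1 // => i; rewrite mul0r. Qed.

Lemma ideal_gen_add s f h :
  ideal_gen s f -> ideal_gen s h -> ideal_gen s (f + h).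
Proof.
move=> [c ->] [d ->]; exists (fun i => c i + d i).
by rewrite -big_split; apply: eq_bigr => i _; rewrite mulrDl.
Qed.

Lemma ideal_gen_mull s x f :
  ideal_gen s f -> ideal_gen s (x * f).
Proof.
move=> [c ->]; exists (fun i => x * c i).
by rewrite mulr_sumr; apply: eq_bigr => i _; rewrite mulrA.
Qed.

(** The shape of a polynomial relation between x, y, z once its
    lexicographically least monomial x^m0 y^m1 z^m2 is normalized to have
    coefficient 1. *)
Definition lex_dependent x y z :=
  exists m0 m1 m2 a0 a1 a2,
    x ^+ m0 * (y ^+ m1 * (z ^+ m2 * (1 + a2 * z) + a1 * y) + a0 * x) = 0.

(** With x, y, z chosen in the successive differences of four nested primes,
    each factor x, y, z of the relation is cancelled modulo the prime that it
    avoids, and the remaining term drops out in the next prime. *)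
Lemma prime_chain_le2 n (P : 'I_n.+1 -> {pred A}) :
  (forall x y z, lex_dependent x y z) -> prime_chain P -> (n <= 2)%N.
Proof.
move=> dep [primeP chainP]; rewrite leqNgt; apply/negP => n_gt2.
have next (i : nat) : (i < 3)%N -> exists x, [/\ x \in P (inord i.+1), x \notin P (inord i)
    & {subset P (inord i) <= P (inord i.+1)}].
  move=> i3; have [|sub nsub] := chainP (inord i) (inord i.+1).
    by rewrite !inordK ?ltnS //; lia.
  have [x xP] : exists x, ~ (x \in P (inord i.+1) -> x \in P (inord i)).
    by apply/existsNP.
  by move/not_implyP: xP => [x1 /negP x0]; exists x.
have [x [x1 x0 s0]] := next 0%N isT; have [y [y2 y1 s1]] := next 1%N isT.
have [z [z3 z2 s2]] := next 2%N isT.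
have [m0 [m1 [m2 [a0 [a1 [a2 rel]]]]]] := dep x y z.
have clD i u v : u \in P i -> v \in P i -> forall a, u + a * v \in P i.
  move=> ui vi a; have [[_ _ cl] _] := primeP i.
  by rewrite addrC; apply: cl.
have clX i u m v : u ^+ m * v \in P i -> u \notin P i -> v \in P i.
  have [_ pr] := primeP i; elim: m => [|m IHm]; first by rewrite expr0 mul1r.
  by rewrite exprS -mulrA => /pr/orP[->//|/IHm].
have clB i u v a : u + a * v \in P i -> v \in P i -> u \in P i.
  by move=> uv vi; have := clD _ _ _ uv vi (- a); rewrite mulNr addrK.
have P0 i : 0 \in P i by have [[]] := primeP i.
have := P0 (inord 0); rewrite -rel => /clX-/(_ x0)/s0/clB-/(_ x1).
move=> /clX-/(_ y1)/s1/clB-/(_ y2)/clX-/(_ z2)/s2/clB-/(_ z3).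
by have [[_ /negP]] := primeP (inord 3).
Qed.

(** The same cancellation, with the ideals generated by the initial segments
    of the sequence in place of the primes. *)
Lemma regular_sequence_le2 s :
  (forall x y z, lex_dependent x y z) -> regular_sequence s -> (size s <= 2)%N.
Proof.
move=> dep [reg proper]; case: s reg proper => [|x [|y [|z s]]] //= reg proper.
case: proper; have [m0 [m1 [m2 [a0 [a1 [a2 rel]]]]]] := dep x y z.
have canc t m u w : ideal_gen t (w ^+ m * u) ->
    (forall v, ideal_gen t (w * v) -> ideal_gen t v) -> ideal_gen t u.
  move=> + cancw; elim: m => [|m IHm]; first by rewrite expr0 mul1r.
  by rewrite exprS -mulrA => /cancw/IHm.
have /ideal_gen_nil/canc/(_ (reg 0%N isT)) := rel.
move=> /ideal_gen_nil/(congr1 (fun u => u - a0 * x)); rewrite addrK sub0r -mulNr.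
move=> eq1; have /canc/(_ (reg 1%N isT)) :
  ideal_gen [:: x] (y ^+ m1 * (z ^+ m2 * (1 + a2 * z) + a1 * y)).
  by apply/ideal_gen1; exists (- a0).
move=> /ideal_gen1[d] /(congr1 (fun u => u - a1 * y)); rewrite addrK -mulNr => eq2.
have /canc/(_ (reg 2%N isT)) : ideal_gen [:: x; y] (z ^+ m2 * (1 + a2 * z)).
  by apply/ideal_gen2; exists d, (- a1).
move=> /ideal_gen2[e [f eq3]].
apply/ideal_gen_cons; exists e, (f * y + - a2 * z); split; last first.
  by rewrite addrA -eq3 mulNr addrK.
apply/ideal_gen_cons; exists f, (- a2 * z); split=> //.
by apply/ideal_gen_cons; exists (- a2), 0; rewrite addr0; split=> //; apply: ideal_gen0.
Qed.

Lemma sum_lowest (c : nat -> A) E i0 x :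
  (i0 < E)%N -> (forall i, (i < i0)%N -> c i = 0) ->
  exists a, \sum_(i < E) c i * x ^+ i = x ^+ i0 * (c i0 + a * x).
Proof.
move=> + c0; elim: E => // E IHE; rewrite ltnS leq_eqVlt => /predU1P[<-|ltE].
  exists 0; rewrite big_ord_recr /= big1 ?add0r => [|i _]; first by rewrite mul0r addr0 mulrC.
  by rewrite c0 ?mul0r.
have [a eqa] := IHE ltE; exists (a + c E * x ^+ (E - i0.+1)).
rewrite big_ord_recr /= eqa -[in x ^+ E](subnKC ltE) exprD exprS; ring.
Qed.

(** The relation is read as a polynomial in x with coefficients polynomials in
    y, and so on; [sum_lowest] is applied once for each variable. *)
Lemma lex_dependent_relation (K : fieldType) (h : {rmorphism K -> A}) E
    (l : nat -> nat -> nat -> K) x y z :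
  (exists i j k, [/\ (i < E)%N, (j < E)%N, (k < E)%N & l i j k != 0]) ->
  \sum_(i < E) (\sum_(j < E) (\sum_(k < E) h (l i j k) * z ^+ k) * y ^+ j) * x ^+ i
    = 0 ->
  lex_dependent x y z.
Proof.
move=> ex_l rel.
pose P0 i := `[< exists j k, [/\ (i < E)%N, (j < E)%N, (k < E)%N & l i j k != 0] >].
have exP0 : exists i, P0 i by case: ex_l => i ?; exists i; apply/asboolP.
case: (ex_minnP exP0) => i /asboolP ex_i min_i.
pose P1 j := `[< exists k, [/\ (i < E)%N, (j < E)%N, (k < E)%N & l i j k != 0] >].
have exP1 : exists j, P1 j by case: ex_i => j ?; exists j; apply/asboolP.
case: (ex_minnP exP1) => j /asboolP ex_j min_j.
pose P2 k := [&& (i < E)%N, (j < E)%N, (k < E)%N & l i j k != 0].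
have exP2 : exists k, P2 k by case: ex_j => k [? ? ? ?]; exists k; apply/and4P.
case: (ex_minnP exP2) => k /and4P[iE jE kE lN0] min_k.
(* Each of i, j, k is the least one that can be completed to a triple with a
   nonzero coefficient. *)
have [i' i'i|a0 e0] := sum_lowest (c := fun i =>
    \sum_(j < E) (\sum_(k < E) h (l i j k) * z ^+ k) * y ^+ j) x iE.
  rewrite big1 // => j' _; rewrite big1 ?mul0r // => k' _.
  have [->|lN] := eqVneq (l i' j' k') 0; first by rewrite rmorph0 mul0r.
  suff /min_i : P0 i' by lia.
  by apply/asboolP; exists j', k'; split=> //; apply: ltn_trans iE.
have [j' j'j|a1 e1] := sum_lowest (c := fun j => \sum_(k < E) h (l i j k) * z ^+ k) y jE.
  rewrite big1 // => k' _.
  have [->|lN] := eqVneq (l i j' k') 0; first by rewrite rmorph0 mul0r.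
  suff /min_j : P1 j' by lia.
  by apply/asboolP; exists k'; split=> //; apply: ltn_trans jE.
have [k' k'k|a2 e2] := sum_lowest (c := fun k => h (l i j k)) z kE.
  have [->|lN] := eqVneq (l i j k') 0; first by rewrite rmorph0.
  suff /min_k : P2 k' by lia.
  by apply/and4P; split=> //; apply: ltn_trans kE.
move: rel; rewrite e0 e1 e2 => /(congr1 (fun u => h (l i j k)^-1 * u)).
rewrite mulr0 => rel.
set u := h (l i j k)^-1 in rel.
have uE : u * h (l i j k) = 1 by rewrite /u -rmorphM mulVf ?rmorph1.
exists i, j, k, (u * a0), (u * a1), (u * a2); rewrite -[RHS]rel -uE; ring.
Qed.
End Ideals.

Lemma linear_dependence (K : fieldType) (U : finType) n (f : U -> 'I_n -> K) :
  (n < #|U|)%N ->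
  exists l : U -> K, (exists u, l u != 0) /\ forall j, \sum_u l u * f u j = 0.
Proof.
move=> ltnU; pose M := \matrix_(u < #|U|, j < n) f (enum_val u) j.
have : kermx M != 0.
  rewrite kermx_eq0 /row_free neq_ltn (leq_ltn_trans _ ltnU) //; exact: rank_leq_col.
move=> /rowV0Pn[v /sub_kermxP vM v0].
exists (fun u => v 0 (enum_rank u)); split.
  have /rV0Pn[i vi] := v0; exists (enum_val i); by rewrite enum_valK.
move=> j; have /rowP/(_ j) := vM; rewrite !mxE => eq0; rewrite -[RHS]eq0.
rewrite (reindex (@enum_val U U)) /=; last by apply/onW_bij/enum_val_bij.
by apply: eq_bigr => i _; rewrite enum_valK mxE.
Qed.

(** * Quotients of polynomial rings by monomials *)

Section MonomialQuotient.
Variables (K : fieldType) (s : nat) (A : comNzRingType).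
Variables (phi : {rmorphism {mpoly K[s]} -> A}) (N : pred 'X_{1..s}).
Hypothesis phi_surj : forall f, exists p, phi p = f.
Hypothesis phi_ker : forall p, phi p = 0 <-> forall m, N m -> p@_m = 0.

Lemma msize_exp_le (p : {mpoly K[s]}) i : (msize (p ^+ i) <= i * (msize p).+1 + 1)%N.
Proof.
elim: i => [|i IHi]; first by rewrite expr0 msize1.
by rewrite exprS (leq_trans (msizeM_le _ _)) // mulSn -addnA addSn ltnS leq_add2l.
Qed.

(** The monomials in x, y, z with exponents at most E are (E+1)^3 in number and
    involve O(E^2) standard monomials, so they are linearly dependent for E
    large.  The cover [t] may contain superfluous monomials. *)
Lemma lex_dependent_growth C :
  (forall D, exists t : seq 'X_{1..s}, (size t <= C * D.+1 ^ 2)%N /\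
     forall m, N m -> (mdeg m <= D)%N -> m \in t) ->
  forall x y z : A, lex_dependent x y z.
Proof.
move=> growth x y z.
have [p <-] := phi_surj x; have [q <-] := phi_surj y; have [r <-] := phi_surj z.
pose D := ((msize p).+1 + (msize q).+1 + (msize r).+1)%N.
(* This value of E makes C * (M + 1)^2 smaller than (E + 1)^3. *)
pose E := (C * (D + 6) ^ 2)%N; pose M := (E.+1 * (D + 5))%N.
have [t [size_t t_cover]] := growth M.
pose g (u : 'I_E.+1 * 'I_E.+1 * 'I_E.+1) := r ^+ u.2 * q ^+ u.1.2 * p ^+ u.1.1.
have [|l [[u lu] rel]] := @linear_dependence K _ (size t)
    (fun u j => (g u)@_(nth 0%MM t j)).
  rewrite !card_prod !card_ord (leq_ltn_trans size_t) // /M.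
  apply: (@leq_ltn_trans (C * (E.+1 * (D + 6)) ^ 2)).
    by rewrite leq_mul2l leq_exp2r //; apply/orP; right; lia.
  rewrite expnMn mulnCA -/E; apply: (@leq_trans (E.+1 ^ 2 * E.+1)).
    by rewrite ltn_pmul2l ?expn_gt0.
  by rewrite -mulnn.
have /phi_ker eq0 : forall m, N m -> (\sum_u (l u)%:MP * g u)@_m = 0.
  move=> m Nm; rewrite raddf_sum /=; under eq_bigr do rewrite mcoeffCM.
  have [mM|Mm] := leqP (mdeg m) M.
    have mt := t_cover m Nm mM; have := rel (Ordinal (etrans (index_mem m t) mt)).
    by rewrite /= nth_index.
  rewrite big1 // => -[[i j] k] _; rewrite memN_msupp_eq0 ?mulr0 //.
  apply: msize_mdeg_ge; rewrite /g /=; apply: leq_trans Mm.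
  have := msizeM_le (r ^+ k * q ^+ j) (p ^+ i); have := msizeM_le (r ^+ k) (q ^+ j).
  have := msize_exp_le p i; have := msize_exp_le q j; have := msize_exp_le r k.
  have le_mul (a : 'I_E.+1) b : (a * b <= E.+1 * b)%N.
    by rewrite leq_mul2r ltnW ?orbT.
  have := le_mul i (msize p).+1; have := le_mul j (msize q).+1; have := le_mul k (msize r).+1.
  rewrite /M /D !mulnDr.
  move: (msize p) (msize q) (msize r) (msize (p ^+ i)) (msize (q ^+ j)) (msize (r ^+ k)).
  by move: (msize (r ^+ k * q ^+ j)) (msize (_ * p ^+ i)) => *; lia.
apply: (@lex_dependent_relation _ K (phi \o @mpolyC s K) E.+1
  (fun i j k => l (inord i, inord j, inord k))).
  by case: u lu => [[i j] k] lu; exists i, j, k; rewrite !inord_val; split.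
rewrite -[RHS]eq0 rmorph_sum /=.
transitivity (\sum_i \sum_j \sum_k phi ((l (i, j, k))%:MP * g (i, j, k))).
  apply: eq_bigr => i _; rewrite mulr_suml; apply: eq_bigr => j _.
  rewrite !mulr_suml; apply: eq_bigr => k _.
  by rewrite !inord_val !rmorphM !rmorphXn /= !mulrA.
by rewrite pair_bigA pair_bigA; apply: eq_bigr => -[[i j] k] _.
Qed.

Definition avoids (S : pred 'I_s) (m : 'X_{1..s}) := [forall i, S i ==> (m i == 0%N)].

(** The substitution of 0 for the variables in S: all that matters below is that
    it is a ring morphism and which coefficients it keeps. *)
Fact kill_subproof S : {h : {rmorphism {mpoly K[s]} -> {mpoly K[s]}} |
  forall p m, (h p)@_m = if avoids S m then p@_m else 0}.
Proof.
exists (mmap (@mpolyC s K) (fun i => if S i then 0 else 'X_i)) => p m.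
have killX m' : mmap1 (fun i => if S i then 0 else 'X_i) m' =
    if avoids S m' then 'X_[m'] else 0 :> {mpoly K[s]}.
  case: ifP => [/forallP avo|/negbT/forallPn[i]].
    rewrite mpolyXE_id; apply: eq_bigr => i _; case: ifP => // Si.
    by have := avo i; rewrite Si => /eqP ->.
  rewrite negb_imply => /andP[Si mi].
  by rewrite /mmap1 (bigD1 i) //= Si expr0n (negbTE mi) mul0r.
rewrite /= /mmap raddf_sum /=; under eq_bigr do rewrite killX mcoeffCM.
case: ifP => avo; last first.
  rewrite big1 // => m' _; case: ifP => avo'; last by rewrite mcoeff0 mulr0.
  rewrite mcoeffX; have [eqm|] := eqVneq m' m; last by rewrite mulr0.
  by rewrite -eqm avo' in avo.
rewrite [in RHS](mpolyE p) raddf_sum /=; apply: eq_bigr => m' _; rewrite mcoeffZ.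
case: ifP => // avo'; rewrite mcoeff0 mcoeffX; have [eqm|] := eqVneq m' m; last by [].
by rewrite eqm avo in avo'.
Qed.

Definition kill S := sval (kill_subproof S).

Lemma mcoeff_kill S p m : (kill S p)@_m = if avoids S m then p@_m else 0.
Proof. exact: (svalP (kill_subproof S)). Qed.

Lemma killU S i : kill S 'X_i = if S i then 0 else 'X_i.
Proof.
apply/mpolyP => m; rewrite mcoeff_kill (fun_if (mcoeff m)) mcoeff0 mcoeffX.
have [<-|_] := eqVneq U_(i)%MM m; last by rewrite !if_same.
suff -> : avoids S U_(i) = ~~ S i by case: (S i).
apply/forallP/idP => [/(_ i)|nSi j]; first by rewrite mnm1E eqxx implybF.
by rewrite mnm1E; have [<-|] := eqVneq i j; rewrite ?(negbTE nSi) ?implybT.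
Qed.

(** The prime generated by the variables in S; it is prime when every monomial
    in the other variables is standard, because the quotient is then a
    polynomial ring. *)
Definition face_ideal S : {pred A} :=
  fun f => `[< exists p, phi p = f /\ kill S p = 0 >].

Lemma face_idealE S p : (forall m, avoids S m -> N m) ->
  phi p \in face_ideal S = (kill S p == 0).
Proof.
move=> S_N; apply/asboolP/eqP => [[q [eq_pq kq]]|kp]; last by exists p.
have /phi_ker ker_pq : phi (p - q) = 0 by rewrite rmorphB eq_pq subrr.
suff: kill S (p - q) = 0 by rewrite rmorphB kq subr0.
apply/mpolyP => m; rewrite mcoeff_kill mcoeff0; case: ifP => // /S_N; exact: ker_pq.
Qed.

Lemma face_ideal_prime S : (forall m, avoids S m -> N m) ->
  prime_ideal (face_ideal S).
Proof.
move=> S_N; split; first split.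
- by rewrite -(rmorph0 phi) (face_idealE _ S_N) rmorph0.
- by rewrite -(rmorph1 phi) (face_idealE _ S_N) rmorph1 oner_eq0.
- move=> a u v; have [p <-] := phi_surj a; have [q <-] := phi_surj u.
  have [r <-] := phi_surj v; rewrite -rmorphM -rmorphD.
  rewrite (face_idealE q S_N) (face_idealE r S_N) (face_idealE (p * q + r) S_N).
  by move=> /eqP kq /eqP kr; rewrite rmorphD rmorphM kq kr mulr0 addr0.
move=> u v; have [p <-] := phi_surj u; have [q <-] := phi_surj v.
rewrite -rmorphM (face_idealE p S_N) (face_idealE q S_N) (face_idealE (p * q) S_N).
by rewrite rmorphM mulf_eq0.
Qed.

Lemma face_ideal_sub (S S' : pred 'I_s) :
    (forall i, S i -> S' i) ->
  {subset face_ideal S <= face_ideal S'}.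
Proof.
move=> subS f; have S'_S m : avoids S' m -> avoids S m.
  move=> /forallP avo; apply/forallP => i; apply/implyP => /subS Si.
  by have := avo i; rewrite Si.
case/asboolP => p [<- kp]; apply/asboolP; exists p; split; first by [].
apply/mpolyP => m; rewrite (mcoeff_kill S' p m) mcoeff0; case: ifP => // /S'_S avo.
by move/mpolyP/(_ m): kp; rewrite (mcoeff_kill S p m) avo mcoeff0.
Qed.

Lemma face_ideal_var (S : pred 'I_s) i : (forall m, avoids S m -> N m) ->
  (phi 'X_i \in face_ideal S) = S i.
Proof.
move=> S_N; rewrite face_idealE // killU.
by case: (S i); rewrite ?eqxx // -msize_poly_eq0 msizeX.
Qed.

(** The k-th prime is generated by the variables of rank at most k. *)
Lemma face_ideal_chain d (rank : 'I_s -> nat) :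
    (forall m : 'X_{1..s}, (forall i, rank i = 0%N -> m i = 0%N) -> N m) ->
    (forall k, (0 < k <= d)%N -> exists i, rank i = k) ->
  exists P : 'I_d.+1 -> {pred A}, prime_chain P.
Proof.
move=> rank0 rankS; pose S k : pred 'I_s := fun i => (rank i <= k)%N.
have S_N k m : avoids (S k) m -> N m.
  move=> /forallP avo; apply: rank0 => i ri; have := avo i.
  by rewrite /S ri leq0n => /eqP.
exists (fun k => face_ideal (S k)); split=> [k|j k ltjk].
  by apply: face_ideal_prime; apply: S_N.
split; first by apply: face_ideal_sub => i Si; apply: leq_trans Si (ltnW ltjk).
have [|i ri] := rankS k; first by rewrite (leq_ltn_trans _ ltjk) //= -ltnS ltn_ord.
move=> sub; suff: S j i by rewrite /S ri leqNgt ltjk.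
by rewrite -(face_ideal_var i (S_N j)); apply: sub; rewrite (face_ideal_var i (S_N k)) /S ri.
Qed.

Lemma regular_pair (t1 t2 : {mpoly K[s]}) :
    N 0%MM -> t1@_0%MM = 0 -> t2@_0%MM = 0 ->
    (forall p, phi (t1 * p) = 0 -> phi p = 0) ->
    (forall p q, phi (t2 * p) = phi (t1 * q) -> exists r, phi p = phi (t1 * r)) ->
  regular_sequence [:: phi t1; phi t2].
Proof.
move=> N0 t10 t20 reg1 reg2; split.
  case=> [|[|//]] _ u /=; have [p <-] := phi_surj u.
    by rewrite !ideal_gen_nil -rmorphM => /reg1.
  rewrite !ideal_gen1 => -[c]; have [q <-] := phi_surj c.
  rewrite -!rmorphM [q * t1]mulrC => /reg2[r ->]; exists (phi r).
  by rewrite rmorphM mulrC.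
move=> /ideal_gen2[c [d]]; have [q <-] := phi_surj c; have [r <-] := phi_surj d.
rewrite -!rmorphM -rmorphD => eq1.
have /phi_ker/(_ _ N0)/eqP : phi (1 - (q * t1 + r * t2)) = 0.
  by rewrite rmorphB rmorph1 eq1 subrr.
rewrite mcoeffB mcoeffD !(rmorphM (mcoeff 0%MM)) /= t10 t20 !mulr0 addr0 subr0.
by rewrite mcoeff1 eqxx oner_eq0.
Qed.

(** The variables of rank 0 generate a prime with quotient a polynomial ring in
    the other variables, and those of ranks 1 and 2 lengthen it to a chain. *)
Lemma monomial_quotient_CM (M : A -> Prop) C (rank : 'I_s -> nat) (t1 t2 : {mpoly K[s]}) :
    (forall D, exists t : seq 'X_{1..s}, (size t <= C * D.+1 ^ 2)%N /\
       forall m, N m -> (mdeg m <= D)%N -> m \in t) ->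
    (forall m : 'X_{1..s}, (forall i, rank i = 0%N -> m i = 0%N) -> N m) ->
    (exists i, rank i = 1%N) -> (exists i, rank i = 2%N) ->
    M (phi t1) -> M (phi t2) -> t1@_0%MM = 0 -> t2@_0%MM = 0 ->
    (forall p, phi (t1 * p) = 0 -> phi p = 0) ->
    (forall p q, phi (t2 * p) = phi (t1 * q) -> exists r, phi p = phi (t1 * r)) ->
  graded_cohen_macaulay M.
Proof.
move=> growth rank0 rank1 rank2 Mt1 Mt2 t10 t20 reg1 reg2.
have dep := lex_dependent_growth growth; exists 2%N; split; split.
- by apply: (face_ideal_chain rank0) => -[|[|[|k]]].
- by move=> n P; apply: prime_chain_le2.
- exists [:: phi t1; phi t2]; split=> //.
    by move=> f; rewrite !inE => /orP[] /eqP ->.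
  by apply: regular_pair => //; apply: rank0 => i _; rewrite mnm0E.
by move=> t _; apply: regular_sequence_le2.
Qed.

End MonomialQuotient.
Arguments kill {K s} S.

(** * The fiber cone of a monomial ideal in two variables *)

Lemma msupp_ind (K : fieldType) n (Q : {mpoly K[n]} -> Prop) f :
  Q 0 -> (forall p q, Q p -> Q q -> Q (p + q)) ->
  (forall v c, v \in msupp f -> Q (c *: 'X_[v])) -> Q f.
Proof.
move=> Q0 QD QX; rewrite [f]mpolyE big_seq; apply: (big_ind Q) => // v; exact: QX.
Qed.

Lemma ideal_gen_monomials (K : fieldType) n (vs : seq 'X_{1..n}) (f : {mpoly K[n]}) :
  ideal_gen [seq 'X_[v] | v <- vs] f <->
  forall v, v \in msupp f -> exists2 u, u \in vs & (u <= v)%MM.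
Proof.
split=> [[c ->] v /msupp_sum_le/flattenP[_ /mapP[i _ ->]]|f_in].
  move=> /msuppM_le/allpairsP[[v1 v2] /= [_ + ->]].
  have lti : (i < size vs)%N by rewrite -(size_map (@mpolyX n K)).
  rewrite (nth_map 0%MM) // msuppX inE => /eqP ->; exists (nth 0%MM vs i).
    exact: mem_nth.
  by apply: lem_addl.
apply: msupp_ind => [|p q|v c /f_in[u u_in uv]]; first exact: ideal_gen0.
  exact: ideal_gen_add.
rewrite -(submK uv) mpolyXD -mul_mpolyC mulrA; apply: ideal_gen_mull.
by apply: ideal_gen_mem; apply: map_f.
Qed.

Section MonomialIdeal.
Variables (K : fieldType) (s : nat) (g : 'I_s -> 'X_{1..2}).
Variable I : {mpoly K[2]} -> Prop.
Hypothesis I_monomial :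
  forall f, I f <-> forall v, v \in msupp f -> exists i, (g i <= v)%MM.

Local Notation multi := 'X_{1..s}.
Implicit Types (f : {mpoly K[2]}) (v : 'X_{1..2}) (m w : multi).

(** The exponent in K[x, y] of the monomial of exponent w in the generators. *)
Definition expo w : 'X_{1..2} := (\sum_(i < s) g i *+ w i)%MM.

Lemma expoE w j : expo w j = (\sum_(i < s) g i j * w i)%N.
Proof. by rewrite /expo mnm_sumE; apply: eq_bigr => i _; rewrite mulmnE. Qed.

Lemma expo0 : expo 0%MM = 0%MM.
Proof. by apply/mnmP => j; rewrite expoE mnm0E big1 // => i _; rewrite mnm0E muln0. Qed.

Lemma expoD w w' : expo (w + w') = (expo w + expo w')%MM.
Proof.
apply/mnmP => j; rewrite mnmDE !expoE -big_split /=.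
by apply: eq_bigr => i _; rewrite mnmDE mulnDr.
Qed.

Lemma expoU i : expo U_(i) = g i.
Proof.
apply/mnmP => j; rewrite expoE (bigD1 i) //= mnm1E eqxx muln1 big1 ?addn0 // => k.
by rewrite mnm1E eq_sym => /negbTE ->; rewrite muln0.
Qed.

(** The exponents of the monomials in I^k, respectively in m I^k: the latter
    asks for proper divisibility, since m contains all nonconstant monomials. *)
Definition in_power k v := exists w, mdeg w = k /\ (expo w <= v)%MM.
Definition in_mpower k v := exists w, [/\ mdeg w = k, (expo w <= v)%MM & expo w != v].

Lemma idealX_expo w : idealX I (mdeg w) 'X_[expo w].
Proof.
move: {2}(mdeg w) (erefl (mdeg w)) => k.
elim: k w => [|k IHk] w eq_k; rewrite eq_k //.
have [i wi] : exists i, w i != 0%N.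
  case: (pickP (fun i => w i != 0%N)) => [i wi|w0]; first by exists i.
  by move: eq_k; rewrite mdegE big1 // => i _; have /negbFE/eqP := w0 i.
have w_split : w = (U_(i) + (w - U_(i)))%MM.
  by rewrite addmC submK // lep1mP.
have eq_k' : mdeg (w - U_(i)) = k.
  by move: eq_k; rewrite [in mdeg w]w_split mdegD mdeg1 => -[].
rewrite w_split expoD expoU mpolyXD; apply: idealM_mul; last by rewrite -{1}eq_k'; apply: IHk.
by apply/I_monomial => v; rewrite msuppX inE => /eqP ->; exists i; apply: lepm_refl.
Qed.

Lemma idealXP k f : idealX I k f <-> forall v, v \in msupp f -> in_power k v.
Proof.
split; last first.
  move=> f_in; apply: msupp_ind => [|p q|v c /f_in[w [<- wv]]].
  - exact: idealX0.
  - exact: idealX_add.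
  rewrite -(submK wv) mpolyXD -mul_mpolyC mulrA; apply: idealX_mull.
  exact: idealX_expo.
elim: k f => [|k IHk] f.
  by move=> _ v _; exists 0%MM; rewrite mdeg0 expo0; split=> //; apply/mnm_lepP => j; rewrite mnm0E.
move=> [n [u [q [Iu Iq ->]]]] v /msupp_sum_le/flattenP[_ /mapP[i _ ->]].
move=> /msuppM_le/allpairsP[[v1 v2] /= [uv qv ->]].
have [j gj] := (I_monomial (u i)).1 (Iu i) _ uv.
have [w [eq_k ew]] := IHk _ (Iq i) _ qv; exists (U_(j) + w)%MM.
rewrite mdegD mdeg1 eq_k expoD expoU; split=> //; apply/mnm_lepP => l.
by rewrite !mnmDE leq_add //; apply: (mnm_lepP _).
Qed.

Lemma ideal_xyX v : v != 0%MM -> ideal_xy ('X_[v] : {mpoly K[2]}).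
Proof.
move=> v0; have [i vi] : exists i, v i != 0%N.
  case: (pickP (fun i => v i != 0%N)) => [i vi|w0]; first by exists i.
  by case/eqP: v0; apply/mnmP => i; rewrite mnm0E; have /negbFE/eqP := w0 i.
have -> : v = (v - U_(i) + U_(i))%MM by rewrite submK // lep1mP.
rewrite mpolyXD; apply/ideal_gen2; case: i {vi} => -[|[|//]] lt2.
  by exists 'X_[v - U_(Ordinal lt2)], 0; rewrite mul0r addr0; congr (_ * 'X_ _); apply: val_inj.
by exists 0, 'X_[v - U_(Ordinal lt2)]; rewrite mul0r add0r; congr (_ * 'X_ _); apply: val_inj.
Qed.

Lemma idealMP k f :
  idealM (@ideal_xy K) (idealX I k) f <-> forall v, v \in msupp f -> in_mpower k v.
Proof.
split.
  move=> [n [u [q [mu Iq ->]]]] v /msupp_sum_le/flattenP[_ /mapP[i _ ->]].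
  move=> /msuppM_le/allpairsP[[v1 v2] /= [uv qv ->]].
  have [w [eq_k ew]] := (idealXP k (q i)).1 (Iq i) _ qv; exists w; split=> //.
    by apply/mnm_lepP => l; rewrite mnmDE; apply: leq_trans (leq_addl _ _); apply: (mnm_lepP _).
  apply: contraTneq uv => eq_w; have -> : v1 = 0%MM.
    apply/mnmP => l; have /mnm_lepP/(_ l) := ew; rewrite eq_w mnmDE mnm0E; lia.
  rewrite mcoeff_msupp negbK; have /ideal_gen2[c [d ->]] := mu i.
  rewrite mcoeffD !(rmorphM (mcoeff 0%MM)) /= /mX /mY !mcoeffX !mnm1_eq0.
  by rewrite !mulr0 addr0.
move=> f_in; apply: msupp_ind => [|p q|v c /f_in[w [<- wv neq]]].
- exact: idealM0.
- exact: idealM_add.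
rewrite -(submK wv) mpolyXD -mul_mpolyC mulrCA; apply: idealM_mul.
  apply: ideal_xyX; apply: contraNneq neq => eq0.
  by rewrite -[v](submK wv) eq0 add0m.
by apply: idealX_mull; apply: idealX_expo.
Qed.

Local Notation rees_monomial := (fun i => 'X_[g i] *: 'X).

Lemma mmap1_rees w :
  mmap1 rees_monomial w = 'X_[expo w] *: 'X^(mdeg w) :> {poly {mpoly K[2]}}.
Proof.
rewrite /mmap1; under eq_bigr do rewrite exprZn mpolyXn.
by rewrite scaler_prod -mprodXE prodrXr mdegE.
Qed.

(** The ring morphism that sends the i-th variable to the i-th generator times
    t, seen in K[x, y][t]; its image lies in the Rees algebra. *)
Fact rees_poly_subproof : {h : {rmorphism {mpoly K[s]} -> {poly {mpoly K[2]}}} |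
  forall p, h p = \sum_(w <- msupp p) (p@_w *: 'X_[expo w]) *: 'X^(mdeg w)}.
Proof.
exists (mmap (polyC \o @mpolyC 2 K) rees_monomial) => p.
rewrite /= /mmap; apply: eq_bigr => w _.
by rewrite mmap1_rees /= mul_polyC scalerA mul_mpolyC.
Qed.

Definition rees_poly := sval rees_poly_subproof.

Lemma rees_polyE p :
  rees_poly p = \sum_(w <- msupp p) (p@_w *: 'X_[expo w]) *: 'X^(mdeg w).
Proof. exact: (svalP rees_poly_subproof). Qed.

Lemma rees_polyZX c w : rees_poly (c *: 'X_[w]) = (c *: 'X_[expo w]) *: 'X^(mdeg w).
Proof.
have [->|c0] := eqVneq c 0; first by rewrite !scale0r rmorph0.
by rewrite rees_polyE msuppMCX // big_seq1 mcoeffZ mcoeffX eqxx mulr1.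
Qed.

Lemma mcoeff_rees_poly p k v :
  (rees_poly p)`_k@_v = \sum_(w <- msupp p | (mdeg w == k) && (expo w == v)) p@_w.
Proof.
rewrite rees_polyE coef_sum raddf_sum /= [RHS]big_mkcond; apply: eq_bigr => w _.
rewrite coefZ coefXn eq_sym; case: (mdeg w == k); last by rewrite mulr0 mcoeff0.
by rewrite mulr1 mcoeffZ mcoeffX; case: (expo w == v); rewrite ?mulr1 ?mulr0.
Qed.

Lemma rees_poly_in_rees p : rees_poly p \in rees_pred I.
Proof.
apply/rees_predP => k; apply/idealXP => v; rewrite mcoeff_msupp mcoeff_rees_poly => coef_v.
have [w /andP[_ /andP[/eqP <- /eqP <-]]] : exists w,
    (w \in msupp p) && ((mdeg w == k) && (expo w == v)).
  apply: contra_neqP coef_v => nex; rewrite big_seq_cond big1 // => w w_in.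
  by case: nex; exists w.
by exists w; split=> //; apply: lepm_refl.
Qed.

Definition rees_param p : rees I := Rees (rees_poly_in_rees p).

Lemma rees_param_zmod : zmod_morphism rees_param.
Proof. by move=> p q; apply: val_inj; rewrite /= -[LHS]/(rees_poly (p - q)) rmorphB. Qed.

Lemma rees_param_monoid : monoid_morphism rees_param.
Proof.
by split=> [|p q]; apply: val_inj; [exact: (rmorph1 rees_poly) | exact: (rmorphM rees_poly p q)].
Qed.

HB.instance Definition _ := GRing.isZmodMorphism.Build _ _ rees_param rees_param_zmod.
HB.instance Definition _ := GRing.isMonoidMorphism.Build _ _ rees_param rees_param_monoid.

Local Notation piF := \pi_({ideal_quot fiber_ideal I}).

Definition fiber_param : {rmorphism {mpoly K[s]} -> fiber_cone I} :=
  piF \o rees_param.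

Lemma fiber_pi0 (u : rees I) :
  piF u = 0 <-> u \in fiber_ideal I.
Proof.
rewrite -[u in u \in _]subr0 Quotient.idealrBE -(rmorph0 piF).
by split=> [->|/eqP].
Qed.

Variable N : pred 'X_{1..s}.
Hypothesis N_antichain : forall n m,
  N n -> N m -> mdeg m = mdeg n -> (expo m <= expo n)%MM -> m = n.
Hypothesis nonN_reducible : forall m, ~~ N m ->
  exists m', [/\ mdeg m' = mdeg m, (expo m' <= expo m)%MM & expo m' != expo m].

Lemma lepm_anti v v' : (v <= v')%MM -> (v' <= v)%MM -> v = v'.
Proof.
move=> /mnm_lepP le1 /mnm_lepP le2; apply/mnmP => i.
by apply/eqP; rewrite eqn_leq le1 le2.
Qed.

Lemma lepm_neq_mdeg v v' : (v <= v')%MM -> v != v' -> (mdeg v < mdeg v')%N.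
Proof.
move=> le_v neq; rewrite -(submK le_v) mdegD -[X in (X < _)%N]add0n ltn_add2r lt0n mdeg_eq0.
by apply: contraNneq neq => eq0; rewrite -[v'](submK le_v) eq0 add0m.
Qed.

(** Reduction of nonstandard monomials terminates because it lowers the degree
    in K[x, y]. *)
Lemma standard_below m : exists m',
  [/\ N m', mdeg m' = mdeg m & (expo m' <= expo m)%MM].
Proof.
have [d le_d] := ubnP (mdeg (expo m)); elim: d m le_d => // d IHd m le_d.
have [Nm|/nonN_reducible[m1 [deg1 le1 neq1]]] := boolP (N m).
  by exists m; rewrite lepm_refl.
have [|m' [Nm' deg' le']] := IHd m1.
  by apply: leq_trans (lepm_neq_mdeg le1 neq1) _; rewrite -ltnS.
by exists m'; rewrite deg' deg1; split=> //; apply: lepm_trans le1.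
Qed.

(** A standard monomial is minimal among all monomials of its degree, and not
    just among the standard ones: another one would reduce to a standard
    monomial below it. *)
Lemma N_minimal n m : N n -> mdeg m = mdeg n -> (expo m <= expo n)%MM -> m = n.
Proof.
move=> Nn deg le_mn; have [Nm|/nonN_reducible[m1 [deg1 le1 neq1]]] := boolP (N m).
  exact: N_antichain.
have [m' [Nm' deg' le']] := standard_below m1.
have eq_m' : m' = n.
  by apply: N_antichain; rewrite // ?deg' ?deg1 //; exact: lepm_trans le' (lepm_trans le1 le_mn).
case/eqP: neq1; apply: lepm_anti le1 _; apply: lepm_trans le_mn _.
by rewrite -eq_m'.
Qed.

(** For n in N, minimality of n makes p@_n the coefficient of the image of p at
    [expo n], an exponent that does not occur in m I^k. *)
Lemma fiber_param_ker p :
  fiber_param p = 0 <-> forall m, N m -> p@_m = 0.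
Proof.
rewrite -[fiber_param p]/(piF (rees_param p)) fiber_pi0; split.
  move=> /fiber_idealP in_mI n Nn.
  have only_n : (rees_poly p)`_(mdeg n)@_(expo n) = p@_n.
    rewrite mcoeff_rees_poly; have [n_in|n_notin] := boolP (n \in msupp p).
      rewrite big_mkcond (bigD1_seq n) ?msupp_uniq //= !eqxx big1 ?addr0 // => w neq.
      case: ifP => // /andP[/eqP dw /eqP ew]; case/eqP: neq.
      by apply: N_minimal; rewrite // ew lepm_refl.
    rewrite memN_msupp_eq0 // big_seq_cond big1 // => w.
    case/andP=> w_in /andP[/eqP dw /eqP ew]; case/negP: n_notin.
    by rewrite -(N_minimal Nn dw) // ew lepm_refl.
  have [|pN0] := eqVneq p@_n 0; first by [].
  have := in_mI (mdeg n) => /idealMP/(_ (expo n)); rewrite mcoeff_msupp only_n.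
  move=> /(_ pN0)[w [dw ew neq]]; case/eqP: neq.
  by rewrite (N_minimal Nn dw ew).
move=> p0; apply/fiber_idealP => k; apply/idealMP => v.
rewrite mcoeff_msupp mcoeff_rees_poly => coef_v.
have [w /andP[w_in /andP[/eqP <- /eqP <-]]] : exists w,
    (w \in msupp p) && ((mdeg w == k) && (expo w == v)).
  apply: contra_neqP coef_v => nex; rewrite big_seq_cond big1 // => w w_in.
  by case: nex; exists w.
have /nonN_reducible[m' [dm em neq]] : ~~ N w.
  by apply: contraL w_in => /p0/eqP; rewrite mcoeff_eq0.
by exists m'.
Qed.

(** A monomial of I^k that is not itself a product of k generators lies in
    m I^k, so it can be ignored. *)
Lemma idealX_lift k f : idealX I k f -> exists p : {mpoly K[s]},
  (forall j, j != k -> (rees_poly p)`_j = 0)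
  /\ idealM (@ideal_xy K) (idealX I k) (f - (rees_poly p)`_k).
Proof.
move=> /idealXP f_in.
pose liftable h := exists p : {mpoly K[s]},
  (forall j, j != k -> (rees_poly p)`_j = 0)
  /\ idealM (@ideal_xy K) (idealX I k) (h - (rees_poly p)`_k).
apply: (msupp_ind (Q := liftable)) => [|p q [p' [p'0 mp']] [q' [q'0 mq']]|v c /f_in[w [dw ew]]].
- by exists 0; rewrite rmorph0; split=> [j _|]; rewrite coef0 // subr0; apply: idealM0.
- exists (p' + q'); rewrite rmorphD; split=> [j jk|].
    by rewrite coefD (p'0 j jk) (q'0 j jk) addr0.
  by rewrite coefD opprD addrACA; apply: idealM_add.
have [eq_v|neq_v] := eqVneq (expo w) v.
  exists (c *: 'X_[w]); rewrite rees_polyZX dw eq_v; split=> [j jk|].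
    by rewrite coefZ coefXn (negbTE jk) mulr0.
  by rewrite coefZ coefXn eqxx mulr1 subrr; apply: idealM0.
exists 0; rewrite rmorph0; split=> [j _|]; first by rewrite coef0.
rewrite coef0 subr0; apply/idealMP => v'; move/msuppZ_le; rewrite msuppX inE => /eqP ->.
by exists w.
Qed.

Lemma fiber_param_surj (x : fiber_cone I) : exists p, fiber_param p = x.
Proof.
pose u : rees I := repr x; have /rees_predP u_in := rees_valP u.
have [P P_lift] := choice (fun k => idealX_lift (u_in k)).
exists (\sum_(k < size (rees_val u)) P k).
rewrite -[x]reprK -/u -[fiber_param _]/(piF (rees_param _)).
apply/eqP; rewrite -subr_eq0 -rmorphB; apply/eqP/fiber_pi0; rewrite -opprB rpredN.
apply/fiber_idealP => j; rewrite /= coefB rmorph_sum coef_sum.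
have [ltj|lej] := ltnP j (size (rees_val u)).
  rewrite (bigD1 (Ordinal ltj)) //= big1 ?addr0 => [|k neq]; first exact: (P_lift j).2.
  by apply: (P_lift k).1; rewrite eq_sym.
rewrite nth_default // big1 ?subr0 => [|k _]; first exact: idealM0.
by apply: (P_lift k).1; rewrite neq_ltn (leq_trans (ltn_ord k) lej) orbT.
Qed.

Lemma fiber_param_plus i : fiber_cone_plus I (fiber_param 'X_i).
Proof.
exists (rees_param 'X_i); split=> //.
by rewrite /= -['X_i]scale1r rees_polyZX mdeg1 coefZ coefXn mulr0.
Qed.

End MonomialIdeal.

Lemma fiber_cone_plusD (K : fieldType) (I : {mpoly K[2]} -> Prop) x y :
  fiber_cone_plus I x -> fiber_cone_plus I y -> fiber_cone_plus I (x + y).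
Proof.
move=> [p [p0 ->]] [q [q0 ->]]; exists (p + q); split; last by rewrite rmorphD.
by rewrite /= coefD p0 q0 addr0.
Qed.

(** * Comparing exponents *)

(** Up to a remainder in {0, a, b}, the two exponents are c * i and c * l, so
    comparability of the exponents bounds i by i' and l by l', with strict
    inequalities when the remainder drops; but i + l is fixed by the degree. *)
Lemma low_antichain a b c i j k l i' j' k' l' : (0 < a)%N -> (a < b)%N -> (b < c)%N ->
    (j + k <= 1)%N -> (j' + k' <= 1)%N -> (i + j + k + l = i' + j' + k' + l')%N ->
    (c * i + b * j + a * k <= c * i' + b * j' + a * k')%N ->
    (a * j + b * k + c * l <= a * j' + b * k' + c * l')%N ->
  [/\ i = i', j = j', k = k' & l = l'].
Proof.
move=> a0 ab bc jk jk' deg le_x le_y.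
have lt_floor x y u v : (c * x + u <= c * y + v)%N -> (v < c)%N -> (x <= y)%N.
  move=> le_xy vc; rewrite leqNgt; apply/negP => ltyx.
  have : (c * y.+1 <= c * x)%N by rewrite leq_mul2l ltyx orbT.
  by rewrite mulnS; lia.
have lt_floor' x y u v : (c * x + u <= c * y + v)%N -> (v < u)%N -> (x < y)%N.
  move=> le_xy vc; rewrite ltnNge; apply/negP => leyx.
  have : (c * y <= c * x)%N by rewrite leq_mul2l leyx orbT.
  lia.
have small u v : (u + v <= 1)%N ->
    [|| (u == 0) && (v == 0), (u == 1) && (v == 0) | (u == 0) && (v == 1)]%N.
  by lia.
have X := lt_floor i i' (b * j + a * k)%N (b * j' + a * k')%N.
have Y := lt_floor l l' (a * j + b * k)%N (a * j' + b * k')%N.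
have X' := lt_floor' i i' (b * j + a * k)%N (b * j' + a * k')%N.
have Y' := lt_floor' l l' (a * j + b * k)%N (a * j' + b * k')%N.
have := small j' k' jk'; have := small j k jk; move=> /or3P[] /andP[/eqP ej /eqP ek];
  subst j k => /or3P[] /andP[/eqP ej /eqP ek]; subst j' k';
  rewrite ?muln0 ?muln1 in le_x le_y X Y X' Y'; split; lia.
Qed.

(** The standard monomials of a fixed degree D, listed by increasing
    y-exponent, first run through those with i > 0, whose y-exponent is below
    a * D, then through those in T1 and T2 alone, then, symmetrically, through
    those with l > 0, whose x-exponent is below a * D.  The x-exponents decrease
    along the list. *)
Lemma high_antichain a d q c i j k l i' j' k' l' : let b := (a + d)%N in
    (0 < d)%N -> (q.-1 * d < a)%N -> (q * d + b < c)%N ->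
    (0 < i -> l = 0 /\ k < q)%N -> (0 < l -> i = 0 /\ j < q)%N ->
    (0 < i' -> l' = 0 /\ k' < q)%N -> (0 < l' -> i' = 0 /\ j' < q)%N ->
    (i + j + k + l = i' + j' + k' + l')%N ->
    (c * i + b * j + a * k <= c * i' + b * j' + a * k')%N ->
    (a * j + b * k + c * l <= a * j' + b * k' + c * l')%N ->
  [/\ i = i', j = j', k = k' & l = l'].
Proof.
move=> b d0 qa qc Ni Nl Ni' Nl' deg le_x le_y.
(* Hence the integers a * s + d * k, for k < q, increase with (s, k) in the
   lexicographic order. *)
have dq x : (x < q)%N -> (d * x < a)%N.
  move=> xq; apply: leq_ltn_trans qa; rewrite mulnC leq_mul2r; apply/orP; right; lia.
have mulS x y : (x < y)%N -> (a * x + a <= a * y)%N.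
  by move=> xy; rewrite addnC -mulnS leq_mul2l xy orbT.
(* Along one side of the Newton polygon the y-exponent a * (v + w) + d * w
   increases with (v + w, w), and the x-exponent decreases. *)
have same_side u v w u' v' w' : (u + v + w = u' + v' + w')%N ->
    (0 < u -> w < q)%N -> (0 < u' -> w' < q)%N ->
    (c * u + b * v + a * w <= c * u' + b * v' + a * w')%N ->
    (a * v + b * w <= a * v' + b * w')%N -> [/\ u = u', v = v' & w = w'].
  move=> eq_deg Nu Nu' le1 le2.
  have le2' : (a * (v + w) + d * w <= a * (v' + w') + d * w')%N by move: le2; rewrite /b; lia.
  have [lt_s|lt_s|eq_s] := ltngtP (v + w)%N (v' + w')%N.
  - have u0 : (0 < u)%N by lia.
    have dw := dq _ (Nu u0).
    have qdw : (d * w <= q * d)%N by rewrite mulnC leq_mul2r ltnW ?orbT ?Nu.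
    exfalso; have [t [t0 eq_s eq_u]] : exists t,
        [/\ (0 < t)%N, (v' + w' = v + w + t)%N & (u = u' + t)%N].
      by exists (v' + w' - (v + w))%N; split; lia.
    have ct : (b * t + q * d < c * t)%N.
      apply: (@leq_trans ((b + (q * d).+1) * t)); last by rewrite leq_mul2r; apply/orP; right; lia.
      by rewrite mulnDl -addnS leq_add2l leq_pmulr.
    have := congr1 (muln a) eq_s; have := congr1 (muln d) eq_s.
    by move: le1 ct; rewrite eq_u /b !mulnDr !mulnDl; lia.
  - have u0 : (0 < u')%N by lia.
    have dw := dq _ (Nu' u0); have := mulS _ _ lt_s; lia.
  have eq_u : u = u' by lia.
  subst u'; move: le1 le2'; rewrite /b eq_s => le1 le2'.
  have : (d * w <= d * w')%N by lia.
  have := congr1 (muln a) eq_s; rewrite !mulnDr => eq_as.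
  have : (d * v <= d * v')%N by move: le1; rewrite !mulnDl; lia.
  rewrite !leq_pmul2l // => vv ww; split; lia.
have a_small u v w : (0 < u)%N -> (w < q)%N -> (a * v + b * w < a * (u + v + w))%N.
  move=> u0 wq; have := dq _ wq; have := mulS _ _ u0; rewrite /b !mulnDr !mulnDl; lia.
have a_large u v w : (c * u + b * v + a * w >= a * (u + v + w))%N.
  by rewrite !mulnDr !leq_add // leq_mul2r; apply/orP; right; rewrite /b; lia.
have [l0|l_gt0] := posnP l; have [l'0|l'_gt0] := posnP l'.
- subst l l'; rewrite !muln0 !addn0 in le_y deg.
  have [||-> -> ->] := same_side i j k i' j' k' deg _ _ le_x le_y; last by [].
  + by move=> /Ni[].
  + by move=> /Ni'[].
- have [i'0 j'q] := Nl' l'_gt0; have := a_small _ k' _ l'_gt0 j'q; have := a_large i j k.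
  have -> : (l' + k' + j' = i + j + k)%N by lia.
  by move: le_x; rewrite i'0 muln0; lia.
all: have [i0 jq] := Nl l_gt0.
  have [i'0|i'_gt0] := posnP i'.
    have [|||||] := same_side l k j l' k' j'; first by lia.
    + by move=> _.
    + by rewrite l'0.
    + by move: le_y; lia.
    + by move: le_x; rewrite i0 i'0; lia.
    by move=> -> -> ->; rewrite i0 i'0.
  have [_ k'q] := Ni' i'_gt0; have := a_small _ j' _ i'_gt0 k'q; have := a_large l k j.
  have -> : (i' + j' + k' = l + k + j)%N by lia.
  by move: le_y; rewrite l'0 muln0; lia.
have [i'0 j'q] := Nl' l'_gt0.
have [|||||] := same_side l k j l' k' j'; first by lia.
- by move=> _.
- by move=> _.
- by move: le_y; lia.
- by move: le_x; rewrite i0 i'0; lia.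
by move=> -> -> ->; rewrite i0 i'0.
Qed.

(** * Division, and polynomials in four variables *)

(** Division by a polynomial that is monic and linear in 'X_i; the polynomials
    fixed by [kill (pred1 i)] are those in which 'X_i does not occur. *)
Lemma linear_division (K : fieldType) n (i : 'I_n) (u p : {mpoly K[n]}) : kill (pred1 i) u = u ->
  exists q r, p = ('X_i + u) * q + r /\ kill (pred1 i) r = r.
Proof.
set ki := kill _ => ku.
pose divides p := exists q r, p = ('X_i + u) * q + r /\ ki r = r.
rewrite -/(divides p).
have divD p1 p2 : divides p1 -> divides p2 -> divides (p1 + p2).
  move=> [q1 [r1 [-> k1]]] [q2 [r2 [-> k2]]]; exists (q1 + q2), (r1 + r2).
  by rewrite rmorphD k1 k2 mulrDr addrACA.
have divXj j p1 : divides p1 -> divides ('X_j * p1).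
  move=> [q [r [-> kr]]]; have [->|ji] := eqVneq j i.
    exists ('X_i * q + r), (- u * r); split; first by ring.
    by rewrite rmorphM rmorphN kr ku.
  exists ('X_j * q), ('X_j * r); split; first by ring.
  by rewrite rmorphM kr /ki killU /= (negbTE ji).
apply: msupp_ind => // [|m c _].
  by exists 0, 0; rewrite mulr0 addr0 rmorph0.
move: {2}(mdeg m) (erefl (mdeg m)) => d; elim: d m => [|d IHd] m.
  move/eqP; rewrite mdeg_eq0 => /eqP ->; exists 0, (c *: 'X_[0]); split; first by rewrite mulr0 add0r.
  apply/mpolyP => m'; rewrite mcoeff_kill; case: ifP => // navo.
  rewrite mcoeffZ mcoeffX; case: eqP => [eq_m|]; rewrite ?mulr0 //.
  by case/negP: (negbT navo); rewrite -eq_m; apply/forallP => j; rewrite mnm0E eqxx implybT.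
move=> dm; have [j mj] : exists j, m j != 0%N.
  case: (pickP (fun j => m j != 0%N)) => [j mj|m0]; first by exists j.
  by move: dm; rewrite mdegE big1 // => j _; have /negbFE/eqP := m0 j.
have eq_m : m = (m - U_(j) + U_(j))%MM by rewrite submK // lep1mP.
rewrite eq_m mpolyXD mulrC scalerAr; apply: divXj.
by apply: IHd; move: dm; rewrite [in mdeg m]eq_m mdegD mdeg1 addn1 => -[].
Qed.

Local Notation x0 := (@Ordinal 4 0 isT).
Local Notation x1 := (@Ordinal 4 1 isT).
Local Notation x2 := (@Ordinal 4 2 isT).
Local Notation x3 := (@Ordinal 4 3 isT).

Implicit Types (m : 'X_{1..4}) (i j k l : nat).

Definition mnm4 i j k l : 'X_{1..4} := [multinom nth 0%N [:: i; j; k; l] n | n < 4].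

Lemma mnm4E i j k l : (mnm4 i j k l x0 = i) * (mnm4 i j k l x1 = j)
  * (mnm4 i j k l x2 = k) * (mnm4 i j k l x3 = l).
Proof. by rewrite !mnmE. Qed.

Lemma ord4P (P : 'I_4 -> Prop) : P x0 -> P x1 -> P x2 -> P x3 -> forall n, P n.
Proof.
by move=> P0 P1 P2 P3 [[|[|[|[|//]]]] lt4]; rewrite (bool_irrelevance lt4 isT).
Qed.

Lemma mnm4_eta m : m = mnm4 (m x0) (m x1) (m x2) (m x3).
Proof. by apply/mnmP; apply: ord4P; rewrite mnm4E. Qed.

Lemma sum_ord4 (F : 'I_4 -> nat) : (\sum_i F i = F x0 + F x1 + F x2 + F x3)%N.
Proof.
rewrite !big_ord_recl big_ord0 addn0 !addnA.
by congr (F _ + F _ + F _ + F _)%N; apply: val_inj.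
Qed.

Lemma mdeg4 m : mdeg m = (m x0 + m x1 + m x2 + m x3)%N.
Proof. by rewrite mdegE sum_ord4. Qed.

Section Coefficients.
Variable K : fieldType.
Implicit Types p : {mpoly K[4]}.

Lemma mcoeffXU n (i : 'I_n) (p : {mpoly K[n]}) (m : 'X_{1..n}) :
  ('X_i * p)@_m = if m i == 0%N then 0 else p@_(m - U_(i)).
Proof.
have [mi|mi] := eqVneq (m i) 0%N; last first.
  by rewrite mulrC -{1}(submK (_ : U_(i) <= m)%MM) ?lep1mP // addmC mcoeffMX.
apply: memN_msupp_eq0; apply/negP => /msuppM_le/allpairsP[[v1 v2] /= [+ _ eq_m]].
rewrite msuppX inE => /eqP eq_v; move: mi.
by rewrite eq_m eq_v mnmDE mnm1E eqxx.
Qed.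

Lemma mcoeffX0 p i j k l : ('X_x0 * p)@_(mnm4 i j k l) =
  if i is i'.+1 then p@_(mnm4 i' j k l) else 0.
Proof.
rewrite mcoeffXU mnm4E; case: i => //= i; congr (p@_ _).
by apply/mnmP; apply: ord4P; rewrite mnmBE !mnm4E mnm1E ?subn0 ?subn1.
Qed.

Lemma mcoeffX1 p i j k l : ('X_x1 * p)@_(mnm4 i j k l) =
  if j is j'.+1 then p@_(mnm4 i j' k l) else 0.
Proof.
rewrite mcoeffXU mnm4E; case: j => //= j; congr (p@_ _).
by apply/mnmP; apply: ord4P; rewrite mnmBE !mnm4E mnm1E ?subn0 ?subn1.
Qed.

Lemma mcoeffX2 p i j k l : ('X_x2 * p)@_(mnm4 i j k l) =
  if k is k'.+1 then p@_(mnm4 i j k' l) else 0.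
Proof.
rewrite mcoeffXU mnm4E; case: k => //= k; congr (p@_ _).
by apply/mnmP; apply: ord4P; rewrite mnmBE !mnm4E mnm1E ?subn0 ?subn1.
Qed.

Lemma mcoeffX3 p i j k l : ('X_x3 * p)@_(mnm4 i j k l) =
  if l is l'.+1 then p@_(mnm4 i j k l') else 0.
Proof.
rewrite mcoeffXU mnm4E; case: l => //= l; congr (p@_ _).
by apply/mnmP; apply: ord4P; rewrite mnmBE !mnm4E mnm1E ?subn0 ?subn1.
Qed.

End Coefficients.

Definition box A B C D := [seq mnm4 u.1 u.2 v.1 v.2
  | u <- [seq (i, j) | i <- iota 0 A, j <- iota 0 B],
    v <- [seq (k, l) | k <- iota 0 C, l <- iota 0 D]].

Lemma size_box A B C D : size (box A B C D) = (A * B * (C * D))%N.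
Proof. by rewrite !size_allpairs !size_iota. Qed.

Lemma mem_box A B C D m : [&& m x0 < A, m x1 < B, m x2 < C & m x3 < D]%N -> m \in box A B C D.
Proof.
case/and4P=> mA mB mC mD; apply/allpairsP; exists ((m x0, m x1), (m x2, m x3)).
by rewrite -mnm4_eta !allpairs_f ?mem_iota.
Qed.

(** When each standard monomial has at least two bounded exponents, at most two
    exponents are free to grow. *)
Lemma two_small_growth (N : pred 'X_{1..4}) r :
    (forall m, N m -> [|| (m x0 < r) && (m x1 < r), (m x2 < r) && (m x3 < r),
       (m x0 < r) && (m x3 < r) | (m x1 < r) && (m x2 < r)]%N) ->
  forall D, exists t : seq 'X_{1..4}, (size t <= 4 * r ^ 2 * D.+1 ^ 2)%N /\
    forall m, N m -> (mdeg m <= D)%N -> m \in t.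
Proof.
move=> N_small D.
exists (box r r D.+1 D.+1 ++ box D.+1 D.+1 r r ++ box r D.+1 D.+1 r ++ box D.+1 r r D.+1).
split; first by rewrite 3!size_cat !size_box; apply: eq_leq; ring.
move=> m /N_small small; rewrite mdeg4 => mD.
have mem_cat4 (t1 t2 t3 t4 : seq 'X_{1..4}) :
    [|| m \in t1, m \in t2, m \in t3 | m \in t4] -> m \in t1 ++ t2 ++ t3 ++ t4.
  by rewrite !mem_cat.
by case/or4P: small => /andP[m1 m2]; apply/mem_cat4/or4P;
  [apply: Or41 | apply: Or42 | apply: Or43 | apply: Or44];
  apply: mem_box; rewrite m1 m2 /= ?andbT; lia.
Qed.

(** * The two regular sequences *)

Section RegularPairs.
Variables (K : fieldType) (A : comNzRingType) (phi : {rmorphism {mpoly K[4]} -> A}).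
Variable N : pred 'X_{1..4}.
Hypothesis phi_ker : forall p, phi p = 0 <-> forall m, N m -> p@_m = 0.

Let phi_ker4 p : phi p = 0 -> forall i j k l, N (mnm4 i j k l) -> p@_(mnm4 i j k l) = 0.
Proof. by move=> /phi_ker p0 i j k l; apply: p0. Qed.

Let phi_ker4E p : (forall i j k l, N (mnm4 i j k l) -> p@_(mnm4 i j k l) = 0) -> phi p = 0.
Proof. by move=> p0; apply/phi_ker => m; rewrite (mnm4_eta m); apply: p0. Qed.

Let phi_eq p q : phi p = phi q <-> phi (p - q) = 0.
Proof. by rewrite rmorphB; split=> [->|/subr0_eq //]; rewrite subrr. Qed.

Lemma free_mcoeff (p : {mpoly K[4]}) i j k l : kill (pred1 x0) p = p -> p@_(mnm4 i.+1 j k l) = 0.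
Proof.
move=> <-; rewrite mcoeff_kill; case: ifP => // /forallP/(_ x0).
by rewrite mnm4E.
Qed.

Section Low.
Hypothesis N_E : forall i j k l, N (mnm4 i j k l) = (j + k <= 1)%N.

Lemma low_regular1 p : phi ('X_x0 * p) = 0 -> phi p = 0.
Proof.
move=> /phi_ker4 p0; apply: phi_ker4E => i j k l; rewrite N_E => Njk.
by have := p0 i.+1 j k l; rewrite N_E mcoeffX0; apply.
Qed.

(** A remainder modulo T0 has no T0, and multiplication by T3 maps the standard
    monomials without T0 injectively to standard monomials without T0. *)
Lemma low_regular2 p q : phi ('X_x3 * p) = phi ('X_x0 * q) ->
  exists r, phi p = phi ('X_x0 * r).
Proof.
have [s [r [-> kr]]] := linear_division (i := x0) p (rmorph0 (kill (K := K) (pred1 x0))).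
rewrite addr0 => /phi_eq/phi_ker4 rel; exists s; apply/phi_eq; rewrite addrAC subrr add0r.
apply: phi_ker4E => -[|i] j k l; last by rewrite free_mcoeff.
rewrite N_E => Njk; have := rel 0%N j k l.+1; rewrite N_E => /(_ Njk).
by rewrite mulrDr mulrCA -addrA [_ - _]addrC addrA -mulrBr mcoeffD mcoeffX0 add0r mcoeffX3.
Qed.
End Low.

Section High.
Variable q : nat.
Hypothesis N_E : forall i j k l, N (mnm4 i j k l) =
  ((0 < i)%N ==> (l == 0%N) && (k < q)%N) && ((0 < l)%N ==> (i == 0%N) && (j < q)%N).

(** The relation says that consecutive coefficients of p along the direction
    T0 / T2 are opposite.  If T2^k stays below the bound q, one follows it
    towards larger powers of T0 and smaller powers of T2, until the power of T2
    is exhausted; otherwise T0 does not occur, and multiplication by T2 alone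
    detects the coefficient. *)
Lemma high_regular1 p : phi (('X_x0 + 'X_x2) * p) = 0 -> phi p = 0.
Proof.
move=> /phi_ker4 rel; apply: phi_ker4E => i j k l Nm.
have [/andP[/eqP l0 kq]|not_bounded] := boolP ((l == 0%N) && (k < q)%N).
  subst l; elim: k i kq {Nm} => [|k IHk] i kq.
    have := rel i.+1 j 0%N 0%N; rewrite N_E kq mulrDl mcoeffD mcoeffX0 mcoeffX2 addr0.
    by apply.
  have := rel i.+1 j k.+1 0%N; rewrite N_E kq mulrDl mcoeffD mcoeffX0 mcoeffX2.
  by rewrite (IHk i.+1 (ltnW kq)) addr0; apply.
have i0 : i = 0%N by move: Nm; rewrite N_E (negbTE not_bounded); case: i.
move: Nm; rewrite i0 => Nm.
have := rel 0%N j k.+1 l; rewrite mulrDl mcoeffD mcoeffX0 mcoeffX2 add0r; apply.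
by move: Nm; rewrite !N_E.
Qed.

(** The standard monomials of F / (T0 + T2), the quotient of K[T1, T2, T3] by
    (T2 T3, T2^(q+1), T3 T1^q). *)
Definition reduced j k l :=
  [&& (k <= q)%N, (k == 0%N) || (l == 0%N) & (l == 0%N) || (j < q)%N].

(** Dividing by T0 + T2, one may assume that p has no T0.  The relation at the
    monomials with T0 then only involves the cofactor [v] and gives [v0]; hence
    the coefficients of (T1 + T3) p at reduced monomials vanish, and those of p
    by induction on the power of T1.  A standard monomial that is not reduced
    and has no T0 contains T2, and replacing this T2 by -T0 gives a nonstandard
    one. *)
Lemma high_regular2 p u : phi (('X_x1 + 'X_x3) * p) = phi (('X_x0 + 'X_x2) * u) ->
  exists r, phi p = phi (('X_x0 + 'X_x2) * r).
Proof.
have k2 : kill (pred1 x0) 'X_x2 = 'X_x2 :> {mpoly K[4]} by rewrite killU.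
have [s [p' [-> kp]]] := linear_division (i := x0) p k2.
set t := 'X_x0 + 'X_x2; set t' := 'X_x1 + 'X_x3 => rel0.
have [v rel] : exists v, phi (t' * p' - t * v) = 0.
  exists (u - t' * s); move/phi_eq: rel0 => <-; congr (phi _); ring.
have free i j k l : p'@_(mnm4 i.+1 j k l) = 0 by apply: free_mcoeff.
have {}rel i j k l := phi_ker4 rel (i := i) (j := j) (k := k) (l := l).
have coefE i j k l : (t' * p' - t * v)@_(mnm4 i j k l) =
   (if j is j'.+1 then p'@_(mnm4 i j' k l) else 0) +
   (if l is l'.+1 then p'@_(mnm4 i j k l') else 0) -
   ((if i is i'.+1 then v@_(mnm4 i' j k l) else 0) +
   (if k is k'.+1 then v@_(mnm4 i j k' l) else 0)).
  by rewrite mcoeffB !mulrDl !mcoeffD mcoeffX0 mcoeffX1 mcoeffX2 mcoeffX3.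
have v0 i j k : (k < q)%N -> v@_(mnm4 i j k 0) = 0.
  elim: k i j => [|k IHk] i j kq.
    have := rel i.+1 j 0%N 0%N; rewrite N_E kq coefE => /(_ isT).
    by case: j => [|j]; rewrite ?free !add0r addr0 => /eqP; rewrite oppr_eq0 => /eqP.
  have := rel i.+1 j k.+1 0%N; rewrite N_E kq coefE (IHk _ _ (ltnW kq)) => /(_ isT).
  by case: j => [|j]; rewrite ?free !add0r addr0 => /eqP; rewrite oppr_eq0 => /eqP.
have relB j k l : reduced j k l ->
   (if j is j'.+1 then p'@_(mnm4 0 j' k l) else 0) +
   (if l is l'.+1 then p'@_(mnm4 0 j k l') else 0) = 0.
  case/and3P=> kq kl jl; have := rel 0%N j k l; rewrite N_E coefE add0r /=.
  case: k kq kl => [|k] kq kl; first by rewrite subr0; apply; case: (l) jl.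
  move: kl => /= /eqP l0; subst l; rewrite v0 // subr0; exact.
have p'0 (j k l : nat) : reduced j k l -> p'@_(mnm4 0 j k l) = 0.
  move=> red; have [/andP[/eqP k0 jq]|not_bounded] := boolP ((k == 0%N) && (j < q)%N).
    subst k; elim: j l jq {red} => [|j IHj] l jq.
      by have := relB 0%N 0%N l.+1; rewrite /reduced jq add0r; apply.
    have := relB j.+1 0%N l.+1; rewrite /reduced jq (IHj _ (ltnW jq)) add0r; exact.
  have l0 : l = 0%N by move: red not_bounded; rewrite /reduced; lia.
  move: red; rewrite l0 => red.
  by have := relB j.+1 k 0%N; rewrite addr0; apply; move: red; rewrite /reduced !orbT.
suff [r eq_r] : exists r, phi p' = phi (t * r).
  by exists (s + r); rewrite rmorphD eq_r mulrDr rmorphD.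
apply: (msupp_ind (Q := fun f => exists r, phi f = phi (t * r)))
  => [|p1 p2 [r1 e1] [r2 e2]|m c m_in].
- by exists 0; rewrite mulr0.
- by exists (r1 + r2); rewrite mulrDr !rmorphD e1 e2.
move: m_in; rewrite mcoeff_msupp (mnm4_eta m); move: (m x0) (m x1) (m x2) (m x3).
move=> i j k l; case: i => [|i]; last by rewrite free eqxx.
move=> p'N0; have not_red : ~~ reduced j k l by apply: contra p'N0 => /p'0 ->.
have [Nm|nNm] := boolP (N (mnm4 0 j k l)); last first.
  exists 0; rewrite mulr0 rmorph0; apply/phi_ker => m' Nm'.
  rewrite mcoeffZ mcoeffX; case: eqP => [eq_m|]; last by rewrite mulr0.
  by rewrite eq_m Nm' in nNm.
have k0 : (0 < k)%N by move: Nm not_red; rewrite N_E /reduced; lia.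
exists (c *: 'X_[mnm4 0 j k.-1 l]); apply/phi_eq.
(* T2 is replaced by -T0. *)
have -> : c *: 'X_[mnm4 0 j k l] - t * (c *: 'X_[mnm4 0 j k.-1 l]) =
    - (c *: 'X_[mnm4 1 j k.-1 l]).
  rewrite -!scalerAr mulrDl -!mpolyXD scalerDr opprD addrCA.
  have -> : (U_(x2) + mnm4 0 j k.-1 l)%MM = mnm4 0 j k l.
    by apply/mnmP; apply: ord4P; rewrite mnmDE mnm1E !mnm4E //= add1n prednK.
  have -> : (U_(x0) + mnm4 0 j k.-1 l)%MM = mnm4 1 j k.-1 l.
    by apply/mnmP; apply: ord4P; rewrite mnmDE mnm1E !mnm4E.
  by rewrite subrr addr0.
apply/phi_ker => m' Nm'; rewrite mcoeffN mcoeffZ mcoeffX.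
case: eqP => [eq_m|]; last by rewrite mulr0 oppr0.
by move: Nm Nm' not_red; rewrite -eq_m !N_E /reduced; lia.
Qed.
End High.
End RegularPairs.

(** * Symmetric ideals *)

Section SymmetricIdeal.
Variables (K : fieldType) (a b c : nat).
Local Notation I := (symmetric_ideal K a b c).

Definition sym_exponents : seq 'X_{1..2} :=
  [:: U_(ord0) *+ c; U_(ord0) *+ b + U_(ord_max) *+ a;
      U_(ord0) *+ a + U_(ord_max) *+ b; U_(ord_max) *+ c]%MM.

Definition sym_expo (i : 'I_4) : 'X_{1..2} := nth 0%MM sym_exponents i.

Lemma symmetric_ideal_monomial f :
  I f <-> forall v, v \in msupp f -> exists i : 'I_4, (sym_expo i <= v)%MM.
Proof.
rewrite /symmetric_ideal.
have -> : [:: mX K ^+ c; mX K ^+ b * mY K ^+ a; mX K ^+ a * mY K ^+ b; mY K ^+ c]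
    = [seq 'X_[v] | v <- sym_exponents].
  by rewrite /= !mpolyXD -!mpolyXn.
rewrite ideal_gen_monomials; split=> f_in v /f_in.
  by move=> [_ /(nthP 0%MM)[i lti <-] le_v]; exists (Ordinal lti).
by move=> [i le_v]; exists (sym_expo i) => //; apply: mem_nth.
Qed.

Local Notation expo := (expo sym_expo).

Lemma sym_expoE w :
  (expo w ord0 = c * w x0 + b * w x1 + a * w x2)%N *
  (expo w ord_max = a * w x1 + b * w x2 + c * w x3)%N.
Proof.
by split; rewrite expoE sum_ord4 /= ?mnmDE !mulmnE !mnm1E /= ?mul0n ?mul1n ?add0n ?addn0.
Qed.

Lemma sym_expo_le w w' : (expo w <= expo w')%MM =
  (c * w x0 + b * w x1 + a * w x2 <= c * w' x0 + b * w' x1 + a * w' x2)%N &&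
  (a * w x1 + b * w x2 + c * w x3 <= a * w' x1 + b * w' x2 + c * w' x3)%N.
Proof.
rewrite -!sym_expoE; apply/mnm_lepP/andP => [le_w|[le0 le1] [[|[|//]] lt2]] //.
  by rewrite (_ : Ordinal lt2 = ord0) //; apply: val_inj.
by rewrite (_ : Ordinal lt2 = ord_max) //; apply: val_inj.
Qed.

(** Equality of exponents is excluded by comparing their total degrees in x and
    y. *)
Lemma sym_reduce i j k l i' j' k' l' :
    (i' + j' + k' + l' = i + j + k + l)%N ->
    (c * i' + b * j' + a * k' <= c * i + b * j + a * k)%N ->
    (a * j' + b * k' + c * l' <= a * j + b * k + c * l)%N ->
    ((c * i' + b * j' + a * k') + (a * j' + b * k' + c * l') <
      (c * i + b * j + a * k) + (a * j + b * k + c * l))%N ->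
  exists m', [/\ mdeg m' = mdeg (mnm4 i j k l), (expo m' <= expo (mnm4 i j k l))%MM &
    expo m' != expo (mnm4 i j k l)].
Proof.
move=> deg le_x le_y lt_xy; exists (mnm4 i' j' k' l').
rewrite !mdeg4 !mnm4E sym_expo_le !mnm4E le_x le_y; split=> //.
apply: contraTneq lt_xy => eq_e; rewrite -leqNgt.
have := sym_expoE (mnm4 i' j' k' l'); rewrite eq_e !sym_expoE !mnm4E => -[-> ->].
by [].
Qed.

(** Here T1 T1, T1 T2 and T2 T2 all reduce to T0 T3. *)
Lemma symmetric_CM_low : (0 < a)%N -> (a < b)%N -> (b < c)%N -> (c <= 2 * a)%N ->
  fiber_cone_CM I.
Proof.
move=> a0 ab bc ca; pose N (m : 'X_{1..4}) := (m x1 + m x2 <= 1)%N.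
have N_E i j k l : N (mnm4 i j k l) = (j + k <= 1)%N by rewrite /N !mnm4E.
have N_anti n m : N n -> N m -> mdeg m = mdeg n -> (expo m <= expo n)%MM -> m = n.
  rewrite (mnm4_eta m) (mnm4_eta n) !N_E !mdeg4 sym_expo_le !mnm4E => Nn Nm deg /andP[le_x le_y].
  by have [-> -> -> ->] := low_antichain a0 ab bc Nm Nn deg le_x le_y.
have N_red m : ~~ N m -> exists m', [/\ mdeg m' = mdeg m, (expo m' <= expo m)%MM &
       expo m' != expo m].
  rewrite (mnm4_eta m) N_E; move: (m x0) (m x1) (m x2) (m x3) => i j k l Njk.
  case: j Njk => [|[|j]] Njk.
  - by case: k Njk => [|[|k]] // _; apply: (@sym_reduce _ _ _ _ i.+1 0 k l.+1); lia.
  - by case: k Njk => [|k] // _; apply: (@sym_reduce _ _ _ _ i.+1 0 k l.+1); lia.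
  - by apply: (@sym_reduce _ _ _ _ i.+1 j k l.+1); lia.
have ker := fiber_param_ker symmetric_ideal_monomial N_anti N_red.
have surj := fiber_param_surj symmetric_ideal_monomial.
have in_plus := fiber_param_plus symmetric_ideal_monomial.
apply: (monomial_quotient_CM surj ker (C := 4 * 2 ^ 2)
  (rank := fun i : 'I_4 => nth 0%N [:: 1; 0; 0; 2] i) (t1 := 'X_x0) (t2 := 'X_x3)).
- by apply: two_small_growth => m; rewrite /N; lia.
- by move=> m m0; rewrite /N !m0.
- by exists x0.
- by exists x3.
- exact: in_plus.
- exact: in_plus.
- by rewrite mcoeffX mnm1_eq0.
- by rewrite mcoeffX mnm1_eq0.
- exact: (low_regular1 ker N_E).
- exact: (low_regular2 ker N_E).
Qed.

(** The reductions are T0 T3 to T1 T2, T0 T2^q to T1^(q+1) and T3 T1^q to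
    T2^(q+1).  The bounds on q d make q minimal with the last two, and the bound
    on c makes them proper. *)
Lemma symmetric_CM_high d q : b = (a + d)%N -> (0 < a)%N -> (0 < d)%N ->
    (q * d < b)%N -> (a <= q * d)%N -> (q * d + b < c)%N ->
  fiber_cone_CM I.
Proof.
move=> b_eq a0 d0 qb qa qc.
pose N (m : 'X_{1..4}) := ((0 < m x0)%N ==> (m x3 == 0%N) && (m x2 < q)%N) &&
                          ((0 < m x3)%N ==> (m x0 == 0%N) && (m x1 < q)%N).
have N_E i j k l : N (mnm4 i j k l) =
  ((0 < i)%N ==> (l == 0%N) && (k < q)%N) && ((0 < l)%N ==> (i == 0%N) && (j < q)%N).
  by rewrite /N !mnm4E.
have N_anti n m : N n -> N m -> mdeg m = mdeg n -> (expo m <= expo n)%MM -> m = n.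
  rewrite (mnm4_eta m) (mnm4_eta n) !N_E !mdeg4 sym_expo_le !mnm4E b_eq.
  have N_prop i j k l :
    ((0 < i)%N ==> (l == 0%N) && (k < q)%N) && ((0 < l)%N ==> (i == 0%N) && (j < q)%N) ->
    ((0 < i)%N -> l = 0%N /\ (k < q)%N) /\ ((0 < l)%N -> i = 0%N /\ (j < q)%N).
    by move=> Nm; split=> pos; move: Nm; rewrite pos; lia.
  move=> /N_prop[Ni Nl] /N_prop[Ni' Nl'] deg /andP[le_x le_y].
  have qa' : (q.-1 * d < a)%N by case: (q) qb => [|q'] //=; rewrite mulSn b_eq; lia.
  have qc' : (q * d + (a + d) < c)%N by rewrite -b_eq.
  by have [-> -> -> ->] := high_antichain d0 qa' qc' Ni' Nl' Ni Nl deg le_x le_y.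
have N_red m : ~~ N m -> exists m', [/\ mdeg m' = mdeg m, (expo m' <= expo m)%MM &
       expo m' != expo m].
  rewrite (mnm4_eta m) N_E; move: (m x0) (m x1) (m x2) (m x3) => i j k l Njk.
  have [il|il] := boolP ((0 < i) && (0 < l))%N.
    case: i l il {Njk} => [|i] [|l] // _.
    by apply: (@sym_reduce _ _ _ _ i j.+1 k.+1 l); lia.
  have [/andP[i0 qk]|ik] := boolP ((0 < i) && (q <= k))%N.
    case: i i0 {Njk il} => // i _; rewrite -(subnK qk); move: (k - q)%N => e.
    apply: (@sym_reduce _ _ _ _ i (j + q.+1) e l); rewrite ?b_eq; [lia | | |].
    - by move: qc; rewrite b_eq; lia.
    - by move: qc; rewrite b_eq; lia.
    - by move: qc; rewrite b_eq; lia.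
  have /andP[l0 qj] : ((0 < l) && (q <= j))%N by lia.
  case: l l0 {Njk il ik} => // l _; rewrite -(subnK qj); move: (j - q)%N => e.
  apply: (@sym_reduce _ _ _ _ i e (k + q.+1) l); rewrite ?b_eq; [lia | | |].
  - by move: qc; rewrite b_eq; lia.
  - by move: qc; rewrite b_eq; lia.
  - by move: qc; rewrite b_eq; lia.
have ker := fiber_param_ker symmetric_ideal_monomial N_anti N_red.
have surj := fiber_param_surj symmetric_ideal_monomial.
have in_plus := fiber_param_plus symmetric_ideal_monomial.
apply: (monomial_quotient_CM surj ker (C := 4 * q.+1 ^ 2)
  (rank := fun i : 'I_4 => nth 0%N [:: 0; 1; 2; 0] i)
  (t1 := 'X_x0 + 'X_x2) (t2 := 'X_x1 + 'X_x3)).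
- by apply: two_small_growth => m; rewrite /N; lia.
- by move=> m m0; rewrite /N (m0 x0) // (m0 x3).
- by exists x1.
- by exists x2.
- by rewrite rmorphD; apply: fiber_cone_plusD; apply: in_plus.
- by rewrite rmorphD; apply: fiber_cone_plusD; apply: in_plus.
- by rewrite mcoeffD !mcoeffX !mnm1_eq0 addr0.
- by rewrite mcoeffD !mcoeffX !mnm1_eq0 addr0.
- exact: (high_regular1 ker N_E).
- exact: (high_regular2 ker N_E).
Qed.
End SymmetricIdeal.

Theorem corollary3p7 (K : fieldType) (a b c : nat) :
  (0 < a)%N -> (a < b)%N -> (b < c)%N ->
  let r : int := Num.ceil (b%:Q / (b%:Q - a%:Q)) in
  c%:Z \notin `[2 * a%:Z + 1, r * (b%:Z - a%:Z) + a%:Z] ->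
  fiber_cone_CM (symmetric_ideal K a b c).
Proof.
move=> a0 ab bc r; rewrite in_itv /= negb_and -!ltNge => /orP[c_low|c_high].
  by apply: symmetric_CM_low => //; lia.
have ba_gt0 : 0 < b%:Q - a%:Q by rewrite subr_gt0 ltr_int ltz_nat.
have /andP[] := ceil_itv (b%:Q / (b%:Q - a%:Q)); rewrite -/r.
rewrite ltr_pdivlMr // ler_pdivrMr // -!intrB -!intrM ltr_int ler_int => r_lt r_ge.
have r_gt0 : 0 < r by rewrite ceil_gt0 divr_gt0 // ltr0z ltz_nat (ltn_trans a0).
(* The ceiling r = q + 1 is characterized by q (b - a) < b <= (q + 1) (b - a). *)
have [q r_eq] : exists q : nat, r = q%:Z + 1 by exists (`|r| - 1)%N; lia.
move: r_lt r_ge c_high; rewrite r_eq addrK => r_lt r_ge c_high.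
have [d b_eq] : exists d, b = (a + d)%N by exists (b - a)%N; lia.
by apply: (@symmetric_CM_high K a b c d q) => //; subst b; lia.
Qed.
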